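(* Let $n$, $k$, $t$ be positive integers with $k\geq t+1$ and $n\geq 2k+1+\delta_{2,q}(1-\delta_{k,t+1})$. Let $V$ be an $n$-dimensional vector space over $\mathbb{F}_q$. If $\mathcal{F}\subseteq {V\brack k}$ is an almost $t$-intersecting family of maximum size (among all almost $t$-intersecting subfamilies of ${V\brack k}$), then there exists $E\in {V\brack t}$ such that $\mathcal{F}=\{F\in {V\brack k}: E\subseteq F\}$.
   Context: $q$ is a prime power. For a vector space $W$ over $\mathbb{F}_q$ and an integer $k$, ${W\brack k}$ denotes the set of all $k$-dimensional subspaces of $W$. A family $\mathcal{F}\subseteq{V\brack k}$ is called almost $t$-intersecting if for each $F\in\mathcal{F}$ there is at most one $F'\in\mathcal{F}$ with $\dim(F\cap F')<t$. $\delta_{a,b}$ denotes the Kronecker delta (equal to $1$ if $a=b$ and $0$ otherwise). *)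

(* Defs.v *)
From HB Require Import structures.
From mathcomp Require Import all_boot all_order all_algebra all_field.
Set Implicit Arguments. Unset Strict Implicit. Unset Printing Implicit Defensive.
Import VectorInternalTheory.

Definition vsp (F : finFieldType) (vT : vectType F) : Type := {vspace vT}.
Notation "[ 'vsp' vT ]" := (@vsp _ vT) (format "[ 'vsp'  vT ]").

HB.instance Definition _ (F : finFieldType) (vT : vectType F) :=
  Countable.copy (vsp vT) (can_type (@vs2mxK F vT)).
HB.instance Definition _ (F : finFieldType) (vT : vectType F) :=
  Finite.copy (vsp vT) (can_type (@vs2mxK F vT)).

Definition kspaces (F : finFieldType) (vT : vectType F) (k : nat)
  : {set [vsp vT]} := [set U : [vsp vT] | \dim U == k].

Definition almost_t_intersecting (F : finFieldType) (vT : vectType F)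
  (t : nat) (Fam : {set [vsp vT]}) : Prop :=
  forall A, A \in Fam ->
    #|[set B in Fam | \dim (A :&: B)%VS < t]| <= 1.

(* Main.v *)
Require Import Defs.
From HB Require Import structures.
From mathcomp Require Import all_boot all_order all_algebra all_field.
From mathcomp Require Import zify ring lra.
Set Implicit Arguments. Unset Strict Implicit. Unset Printing Implicit Defensive.
Import Order.TTheory GRing.Theory Num.Theory.

(** Write [[a, b]] for Gaussian binomials and [theta = [k - t + 1, 1]].  Let [m]
    be the least dimension, at least [t], of a subspace [T] met in dimension at
    least [t] by all members of the family but at most one; every member is such
    a subspace, so [m <= k].  If [t <= dim S < m], some member [A] satisfies
    [dim (S :&: A) < t], and all but at most one of the members containing [S]
    meet [A] in dimension at least [t], hence contain one of [theta] fixed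
    subspaces of dimension [dim S + 1] above [S].  Iterating [y |-> theta y + 1]
    from dimension [m] down to [t] bounds the number of members through each
    [t]-subspace of [T], so the family has size at most
    [[m, t] * iter (m - t) ([n - m, k - m]) + 1].  For [m > t] this is smaller
    than the size [[n - t, k - t]] of a star: the bound decreases in [m], and the
    case [m = t + 1] is where the hypothesis on [n] is needed.  For [m = t] all
    members contain [T], or again the bound for [m = t + 1] applies. *)

(** * Elementary dimension arguments for subspaces *)

Lemma eq_subspace {F : finFieldType} {vT : vectType F} (U V : {vspace vT}) :
  (U <= V)%VS -> \dim V <= \dim U -> U = V.
Proof. by move=> sUV ldim; apply/eqP; rewrite eqEdim sUV. Qed.

Lemma dim_addv_line {F : finFieldType} {vT : vectType F} (R : {vspace vT}) v :
  v \notin R -> \dim (R + <[v]>) = (\dim R).+1.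
Proof.
move=> vR; have v0: v != 0%R by apply: contraNneq vR => ->; exact: mem0v.
rewrite dimv_disjoint_sum ?dim_vline ?v0 ?addn1 //.
apply/eqP; rewrite -subv0; apply/subvP => w /memv_capP[wR /vlineP[a aw]].
have [a0|a0] := eqVneq a 0%R; first by rewrite aw a0 GRing.scale0r mem0v.
by case/negP: vR; rewrite -(GRing.scalerK a0 v) -aw memvZ.
Qed.

Lemma subspace_extend {F : finFieldType} {vT : vectType F} (S M : {vspace vT}) d :
  (S <= M)%VS -> \dim S <= d <= \dim M ->
  exists D : {vspace vT}, [/\ (S <= D)%VS, (D <= M)%VS & \dim D = d].
Proof.
move=> sSM; elim: d => [|d IHd] /andP[lSd ldM].
  by exists S; split=> //; move: lSd; case: (\dim S).
have [eqS|ltS] := eqVneq (\dim S) d.+1; first by exists S.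
have [|D [sSD sDM dD]] := IHd; first by lia.
have /subvPn[v vM vD] : ~~ (M <= D)%VS by apply/negP => /dimvS; lia.
exists (D + <[v]>)%VS; split.
- exact: subv_trans sSD (addvSl _ _).
- by rewrite subv_add sDM.
by rewrite dim_addv_line // dD.
Qed.

(** * Intervals in the subspace lattice, and counting vectors *)

Definition between {F : finFieldType} {vT : vectType F} (R W : {vspace vT}) d
  : {set [vsp vT]} :=
  [set U : [vsp vT] | [&& (R <= U)%VS, (U <= W)%VS & \dim U == d]].

(* [finvect_type] carries its own choice structure, so its subspaces are not
   those of [vT]; this alias only adds an enumeration. *)
Definition vec {F : finFieldType} (vT : vectType F) : Type := vT.
HB.instance Definition _ (F : finFieldType) (vT : vectType F) :=
  Countable.copy (vec vT) (can_type (@VectorInternalTheory.v2rK F vT)).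
HB.instance Definition _ (F : finFieldType) (vT : vectType F) :=
  Finite.copy (vec vT) (can_type (@VectorInternalTheory.v2rK F vT)).

Lemma card_vspaceE {F : finFieldType} {vT : vectType F} (W : {vspace vT}) :
  #|[set v : vec vT | (v : vT) \in W]| = #|F| ^ \dim W.
Proof.
(* Unpacking [vT] exposes its vector space structure [cT], which can then be placed on the finite
   type [vec]. *)
rewrite cardsE; case: vT W => sT cT W.
exact: (@card_vspace F (vec (Vector.Pack cT)) cT).
Qed.

Lemma card_vspaceD {F : finFieldType} {vT : vectType F} (R W : {vspace vT}) :
  (R <= W)%VS ->
  #|[set v : vec vT | ((v : vT) \in W) && ((v : vT) \notin R)]|
    = #|F| ^ \dim W - #|F| ^ \dim R.
Proof.
move=> sRW; rewrite -!card_vspaceE -cardsDS.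
  by apply: eq_card => v; rewrite !inE andbC.
by apply/subsetP => v; rewrite !inE; exact: (subvP sRW).
Qed.

(* Each vector of [W] outside [R] spans with [R] exactly one of the counted
   spaces [U], and [U] arises from the vectors of [U] outside [R]. *)
Lemma card_between_succ {F : finFieldType} {vT : vectType F} (R W : {vspace vT}) :
  (R <= W)%VS ->
  #|between R W (\dim R).+1| * (#|F| - 1) = #|F| ^ (\dim W - \dim R) - 1.
Proof.
move=> sRW; have ldim := dimvS sRW.
have q1 : 0 < #|F| ^ \dim R by rewrite expn_gt0 (ltnW (finNzRing_gt1 F)).
apply/eqP; rewrite -(eqn_pmul2r q1) !mulnBl mul1n -expnD subnK //.
rewrite -card_vspaceD // -mulnA mulnBl -expnS mul1n; apply/eqP.
rewrite -[RHS]sum1_card.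
rewrite (partition_big (fun v : vec vT => (R + <[v : vT]>)%VS : [vsp vT])
  (mem (between R W (\dim R).+1))) => [|v]; last first.
  rewrite !inE => /andP[vW vR]; rewrite addvSl subv_add sRW /=.
  by rewrite dim_addv_line ?eqxx ?andbT.
rewrite -sum_nat_const; apply: eq_bigr => U.
rewrite inE => /and3P[sRU sUW /eqP dU].
rewrite -dU -card_vspaceD // sum1dep_card; apply: eq_card => v; rewrite !inE.
apply/andP/andP => [[vU vR]|[/andP[vW vR] /eqP <-]]; last first.
  by split=> //; apply: (subvP (addvSr _ _)); exact: memv_line.
rewrite (subvP sUW _ vU) vR; split=> //.
apply/eqP; apply: eq_subspace; last by rewrite dim_addv_line // dU.
by rewrite subv_add sRU.
Qed.

(** * Gaussian binomials over an ordered field, and affine iteration *)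

Local Open Scope ring_scope.

(** Taking values in a field makes the absorption recursion a plain quotient. For [n < k] the value
    is 0, since a factor [q ^+ 0 - 1] occurs. *)
Fixpoint gauss {R : fieldType} (q : R) (n k : nat) : R :=
  if k is k'.+1 then (q ^+ n - 1) / (q ^+ k - 1) * gauss q n.-1 k' else 1.

Section GaussBounds.

Variables (R : realFieldType) (q : R).
Hypothesis q_ge2 : 2 <= q.

Lemma exprn_ge1 i : 1 <= q ^+ i.
Proof. by have q2 := q_ge2; apply: exprn_ege1; lra. Qed.

Lemma exprS_sub1_gt0 i : 0 < q ^+ i.+1 - 1.
Proof. by have q2 := q_ge2; rewrite subr_gt0 exprn_egt1 //; lra. Qed.

(** The leading factor of the recursion, with numerator exponent [n + 1] and denominator exponent
    [k + 1], is at least [q ^+ (n - k)]. *)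
Lemma gaussSS_ge n k : (k <= n)%N -> 0 <= gauss q n k ->
  q ^+ (n - k) * gauss q n k <= gauss q n.+1 k.+1.
Proof.
move=> lkn g0; apply: ler_wpM2r => //.
rewrite ler_pdivlMr ?exprS_sub1_gt0 // mulrBr mulr1 -exprD addnS subnK //.
by rewrite lerD2l lerN2 exprn_ge1.
Qed.

Lemma gauss_ge1 n k : (k <= n)%N -> 1 <= gauss q n k.
Proof.
elim: k n => [|k IHk] n lkn; first exact: lexx.
case: n lkn => // n lkn; have g1 := IHk n lkn.
apply: le_trans _ (@gaussSS_ge n k lkn (le_trans ler01 g1)).
by rewrite mulr_ege1 ?exprn_ge1.
Qed.

Lemma gauss_nn n : gauss q n n = 1.
Proof.
elim: n => //= n ->.
by rewrite mulr1 divff // gt_eqF ?exprS_sub1_gt0.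
Qed.

(** The recursion of [gauss] moves both indices; this one moves the upper index alone, as needed to
    compare [bound m.+1] with [bound m]. *)
Lemma gauss_succ m t : (t <= m)%N ->
  gauss q m.+1 t * (q ^+ (m.+1 - t) - 1) = gauss q m t * (q ^+ m.+1 - 1).
Proof.
elim: t m => [|t IHt] [|m] // ltm; rewrite ?mul1r //.
rewrite subSS [gauss q m.+2 _]/= [gauss q m.+1 t.+1]/= -mulrA IHt //; ring.
Qed.

(** For [theta >= 2] each step multiplies [y + 1] by at most [theta]. *)
Lemma iter_affine_le (theta x : R) j : 2 <= theta ->
  iter j (fun y => theta * y + 1) x <= theta ^+ j * (x + 1) - 1.
Proof.
move=> th2; elim: j => [|j IHj] /=; first by rewrite expr0; lra.
by rewrite exprS -mulrA; nra.
Qed.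

Lemma iter_affine_ge (theta x : R) j : 0 <= theta ->
  theta ^+ j * x <= iter j (fun y => theta * y + 1) x.
Proof.
move=> th0; elim: j => [|j IHj] /=; first by rewrite expr0; lra.
by rewrite exprS -mulrA; nra.
Qed.

End GaussBounds.

(** * The numerical comparison with the size of a star *)

Section NumericBound.

Variables (R : realFieldType) (p n k t : nat).
Hypotheses (p_gt1 : (1 < p)%N) (t_gt0 : (0 < t)%N) (ltk : (t + 1 <= k)%N).
Hypothesis lkn : (2 * k + 1 + (p == 2) * (1 - (k == t + 1)) <= n)%N.

Let q : R := p%:R.
Let theta := (q ^+ (k - t).+1 - 1) / (q - 1).
Let bound m :=
  gauss q m t * iter (m - t) (fun y => theta * y + 1) (gauss q (n - m) (k - m)).

Let q_ge2 : 2 <= q.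
Proof. by rewrite ler_nat. Qed.

Lemma q_eq2_or_ge3 : q = 2 \/ 3 <= q.
Proof.
case: (leqP p 2) => h; first by left; rewrite /q (_ : p = 2%N) //; lia.
by right; rewrite ler_nat.
Qed.

Let thetaE : theta * (q - 1) = q ^+ (k - t).+1 - 1.
Proof. by rewrite /theta divfK // subr_eq0; apply/eqP; have := q_ge2; lra. Qed.

Let theta_ge : q + 1 <= theta.
Proof.
rewrite -(ler_pM2r (_ : 0 < q - 1)) ?thetaE; last by have := q_ge2; lra.
have -> : (k - t).+1 = (k - t - 1 + 2)%N by lia.
by rewrite exprD; have := exprn_ge1 q_ge2 (k - t - 1); have := q_ge2; nra.
Qed.

(** With [w = q ^+ (k - t).+1], if [q >= 3] then [theta <= (w - 1) / 2] and the right side is at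
    least [3 * w]. If [q = 2] then [theta = w - 1], and the Kronecker term in the hypothesis on [n]
    provides a second factor 2 on the right. *)
Lemma theta_bound : (t.+1 < k)%N -> 4 * (theta + 2) <= 3 * q ^+ (n - k - t).
Proof.
move=> ltk2; have q2 := q_ge2; have thE := thetaE.
have w_ge : q * q <= q ^+ (k - t).+1.
  by rewrite -expr2 ler_weXn2l //; [lra | lia].
have [q_2|q3] := q_eq2_or_ge3.
  have -> : (n - k - t = (n - k - t - (k - t).+2) + 1 + (k - t).+1)%N.
    have p2 : p = 2%N by apply/eqP; rewrite -(eqr_nat R); apply/eqP.
    move: lkn; rewrite p2 eqxx mul1n; case: eqP; lia.
  rewrite !exprD expr1; move: w_ge thE; set w := q ^+ (k - t).+1 => w_ge thE.
  have e1 := exprn_ge1 q2 (n - k - t - (k - t).+2).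
  have : w <= q ^+ (n - k - t - (k - t).+2) * w by rewrite ler_peMl //; nra.
  by nra.
have : q ^+ (k - t).+1 <= q ^+ (n - k - t) by rewrite ler_weXn2l //; [lra | lia].
by nra.
Qed.

(** Let [rho] be the ratio of the two leading Gaussian binomials. After bounding both iterates by
    powers of [theta] and cancelling, it remains to see that [rho * (theta + 2) <= q ^+ (n - k)].
    This splits into [rho <= 4/3 * q ^+ t] and [theta_bound]. *)
Lemma bound_decr m : (t < m < k)%N -> bound m.+1 <= bound m.
Proof.
case/andP=> ltm lmk; have q2 := q_ge2.
have [j ej] : exists j, (m - t = j.+1)%N by exists (m - t).-1; lia.
have gm := gauss_succ q (ltnW ltm).
have gm1 : 1 <= gauss q m t by apply: gauss_ge1 => //; lia.
have b_ge : q ^+ (n - k) * gauss q (n - m.+1) (k - m.+1) <= gauss q (n - m) (k - m).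
  have -> : (n - m = (n - m.+1).+1)%N by lia.
  have -> : (k - m = (k - m.+1).+1)%N by lia.
  have -> : (n - k = n - m.+1 - (k - m.+1))%N by lia.
  apply: gaussSS_ge => //; first by lia.
  by apply: le_trans ler01 (gauss_ge1 q2 _); lia.
have a_ge1 : 1 <= gauss q (n - m.+1) (k - m.+1) by apply: gauss_ge1 => //; lia.
have enk : (n - k = t + (n - k - t))%N by lia.
have em : (m.+1 - t = j.+2)%N by lia.
have em1 : m.+1 = (t + j.+2)%N by lia.
move: gm; rewrite /bound em ej iterSr.
move: a_ge1 b_ge gm1; set a := gauss q (n - m.+1) _; set b := gauss q (n - m) _.
set g := gauss q m t; set g' := gauss q m.+1 t => a_ge1 b_ge gm1 gm.
have v0 := exprS_sub1_gt0 q2 j.+1.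
pose rho := (q ^+ m.+1 - 1) / (q ^+ j.+2 - 1).
have rhoE : rho * (q ^+ j.+2 - 1) = q ^+ m.+1 - 1 by rewrite divfK ?gt_eqF.
have -> : g' = g * rho by rewrite mulrA -gm mulfK ?gt_eqF.
rewrite -mulrA ler_pM2l; last by lra.
have th3 : 3 <= theta by have := theta_ge; lra.
have rho0 : 0 <= rho by rewrite divr_ge0 ?ltW // exprS_sub1_gt0.
have th_j : 0 <= theta ^+ j.+1 by rewrite exprn_ge0 //; lra.
apply: le_trans (_ : rho * (theta ^+ j.+1 * (theta * a + 2)) <= _).
  apply: ler_wpM2l => //; apply: le_trans (iter_affine_le _ _ _) _ => //; first by lra.
  by rewrite (_ : theta * a + 1 + 1 = theta * a + 2) ?gerBl ?ler01 //; ring.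
apply: le_trans _ (iter_affine_ge _ _ _); last by lra.
rewrite mulrCA; apply: ler_wpM2l => //; apply: le_trans _ b_ge.
(* The constant 4/3 is the largest value of [v / (v - 1)] for [v = q ^+ j.+2 >= 4]. *)
have rho_le : 3 * rho <= 4 * q ^+ t.
  rewrite -(ler_pM2r v0) -mulrA rhoE.
  have u1 := exprn_ge1 q2 t; have v1 := exprn_ge1 q2 j.
  rewrite em1 exprD; set u := q ^+ t in u1 *.
  have : 4 <= q ^+ j.+2 by rewrite !exprS; nra.
  by set v := q ^+ j.+2; nra.
have th_le := theta_bound (leq_ltn_trans ltm lmk).
rewrite enk exprD; move: th_le rho_le.
set u := q ^+ t; set e := q ^+ (n - k - t) => th_le rho_le.
have step1 : rho * (theta * a + 2) <= rho * (theta + 2) * a.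
  by rewrite -mulrA ler_wpM2l // mulrDl; lra.
apply: le_trans step1 _; apply: ler_wpM2r; first by lra.
have u0 : 1 <= u by exact: exprn_ge1.
have s2 : (3 * rho) * (theta + 2) <= (4 * u) * (theta + 2) by apply: ler_wpM2r; lra.
have s3 : u * (4 * (theta + 2)) <= u * (3 * e) by apply: ler_wpM2l; lra.
by lra.
Qed.

Lemma bound_first : bound t.+1 + 1 < gauss q (n - t) (k - t).
Proof.
have q2 := q_ge2; have thE := thetaE; have th_ge := theta_ge.
have yE := gauss_succ q (leqnn t).
rewrite gauss_nn // mul1r subSnn expr1 in yE.
rewrite /bound subSnn [iter 1 _ _]/=.
move: yE; set y := gauss q t.+1 t => yE.
have P1 := exprn_ge1 q2 t.+1.
have y0 : 0 <= y by apply: le_trans ler01 (gauss_ge1 q2 _).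
(* For [k = t + 1] the inner Gaussian binomial is 1 and [theta = q + 1], so [n >= 2k + 1] suffices
   even when [q = 2]. *)
have [ek|nek] := eqVneq k (t + 1)%N.
  have -> : (k - t.+1 = 0)%N by lia.
  have -> : (k - t = 1)%N by lia.
  have th : theta = q + 1.
    move: thE; rewrite ek addKn expr2 => thE.
    by apply: (mulIf (_ : q - 1 != 0)); [rewrite subr_eq0; apply/eqP; lra | rewrite thE; ring].
  rewrite th /= expr1 !mulr1 ltr_pdivlMr; last by lra.
  have : q ^+ (t.+1 + 2) <= q ^+ (n - t) by rewrite ler_weXn2l //; [lra | lia].
  rewrite exprD expr2; set N := q ^+ (n - t); set P := q ^+ t.+1 in yE P1 * => N_ge.
  have qq : q + 2 <= q * q by nra.
  have : (P - 1) * (q + 2) <= (P - 1) * (q * q) by apply: ler_wpM2l; lra.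
  have -> : (y * (q + 1 + 1) + 1) * (q - 1) = (P - 1) * (q + 2) + (q - 1).
    by rewrite -yE; ring.
  by lra.
have d2 : (1 < k - t)%N by lia.
have NE : gauss q (n - t) (k - t) * (q ^+ (k - t) - 1)
    = (q ^+ (n - t) - 1) * gauss q (n - t.+1) (k - t.+1).
  have -> : (n - t = (n - t.+1).+1)%N by lia.
  have -> : (k - t = (k - t.+1).+1)%N by lia.
  by rewrite /= mulrAC divfK // gt_eqF ?exprS_sub1_gt0.
have a_ge : q ^+ k.+1 <= gauss q (n - t.+1) (k - t.+1).
  have -> : (n - t.+1 = (n - t.+2).+1)%N by lia.
  have -> : (k - t.+1 = (k - t.+2).+1)%N by lia.
  have g1 : 1 <= gauss q (n - t.+2) (k - t.+2) by apply: gauss_ge1 => //; lia.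
  apply: le_trans _ (gaussSS_ge _ _ _) => //; [|by lia|by apply: le_trans ler01 g1].
  apply: le_trans (_ : q ^+ (n - t.+2 - (k - t.+2)) <= _).
    by rewrite ler_weXn2l //; [lra | lia].
  by rewrite ler_peMr // exprn_ge0 //; lra.
have D_ge : q * q <= q ^+ (k - t) by rewrite -expr2 ler_weXn2l //; lra.
have PD : q ^+ k.+1 = q ^+ t.+1 * q ^+ (k - t) by rewrite -exprD; congr (_ ^+ _); lia.
rewrite -(ltr_pM2r (_ : 0 < q ^+ (k - t) - 1)) ?NE; last by nra.
have D2 : 2 < q ^+ (k - t) ^+ 2.
  by rewrite expr2; set D := q ^+ (k - t) in D_ge *; have D4 : 4 <= D; nra.
(* This is [key] below multiplied by [(q - 1) ^+ 2], which clears the denominators of [y] and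
   [theta], with the left side enlarged: [q * D - 1] and [D - 1] become [q * D] and [D], and the
   constant 2 becomes [D ^+ 2]. *)
have nt_ge : q * (q ^+ t.+1 - 1) * q ^+ (k - t) ^+ 2
    + (q - 1) ^+ 2 * q ^+ (k - t) ^+ 2 <= (q - 1) ^+ 2 * q ^+ (n - t).
  have [q_2|q3] := q_eq2_or_ge3.
    have : q ^+ (1 + t.+1 + (k - t) + (k - t)) <= q ^+ (n - t).
      have p2 : p = 2%N by apply/eqP; rewrite -(eqr_nat R); apply/eqP.
      rewrite ler_weXn2l //; first by lra.
      by move: lkn; rewrite p2 eqxx mul1n; case: eqP; lia.
    rewrite !exprD expr1 => N_ge; move: N_ge; rewrite expr2.
    set P := q ^+ t.+1; set D := q ^+ (k - t); set N := q ^+ (n - t).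
    by have := sqr_ge0 D; rewrite q_2 expr2; lra.
  have : q ^+ (t.+1 + (k - t) + (k - t)) <= q ^+ (n - t).
    by rewrite ler_weXn2l //; [lra | lia].
  rewrite !exprD -[_ * _ * _]mulrA -expr2; set P := q ^+ t.+1 in P1 *.
  set D := q ^+ (k - t) ^+ 2 in D2 *; set N := q ^+ (n - t) => N_ge.
  have qq : q <= (q - 1) ^+ 2 by rewrite expr2; nra.
  have : (q - 1) ^+ 2 * (P * D) <= (q - 1) ^+ 2 * N by rewrite ler_wpM2l ?sqr_ge0.
  have : q * ((P - 1) * D) <= (q - 1) ^+ 2 * ((P - 1) * D).
    by rewrite ler_wpM2r // mulr_ge0; lra.
  by set c := (q - 1) ^+ 2; lra.
move: thE nt_ge PD a_ge D_ge D2 P1 yE; rewrite [q ^+ (k - t).+1]exprS.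
set D := q ^+ (k - t); set P := q ^+ t.+1; set N := q ^+ (n - t).
set a := gauss q _ _ => thE nt_ge PD a_ge D_ge D2 P1 yE.
have D4 : 4 <= D by nra.
have c0 : 0 < (q - 1) ^+ 2 by rewrite exprn_gt0 //; lra.
(* The summand 2 leaves room for [2 * a] after multiplying by [a]: one [a] absorbs
   [(y + 1) * (D - 1)], the other the [-1] in [(N - 1) * a]. *)
have key : y * theta * (D - 1) + 2 < N.
  rewrite -(ltr_pM2l c0); apply: lt_le_trans _ nt_ge.
  have -> : (q - 1) ^+ 2 * (y * theta * (D - 1) + 2)
      = y * (q - 1) * (theta * (q - 1)) * (D - 1) + (q - 1) ^+ 2 * 2 by ring.
  rewrite yE thE; apply: ler_ltD; last by rewrite ltr_pM2l.
  have -> : q * (P - 1) * D ^+ 2 = (P - 1) * (q * D * D) by ring.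
  by rewrite -mulrA ler_wpM2l //; [lra | nra].
have yP : y + 1 <= P by nra.
have a0 : 0 < a by apply: lt_le_trans _ a_ge; rewrite exprn_gt0 //; lra.
have yD : (y + 1) * (D - 1) <= a.
  by apply: le_trans _ a_ge; rewrite PD ler_pM //; lra.
have : (y * theta * (D - 1) + 2) * a < N * a by rewrite ltr_pM2r.
have -> : (y * (theta * a + 1) + 1) * (D - 1)
    = y * theta * (D - 1) * a + (y + 1) * (D - 1) by ring.
by lra.
Qed.

Lemma bound_lt m : (t < m <= k)%N -> bound m + 1 < gauss q (n - t) (k - t).
Proof.
elim: m => // m IHm /andP[ltm lmk].
have [etm|netm] := eqVneq t m; first by rewrite -etm bound_first.
have ltm' : (t < m)%N by lia.
by apply: le_lt_trans (IHm _); rewrite ?lerD2r ?bound_decr ?ltm' //=; lia.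
Qed.
End NumericBound.

(** * Counting intervals of subspaces, and extensions that meet a given space *)

Section Counting.

Variables (F : finFieldType) (vT : vectType F).
Implicit Types R S T U W : {vspace vT}.
Let q : rat := #|F|%:R.

Lemma card_field_gt1 : 1 < q.
Proof. by rewrite ltr1n finNzRing_gt1. Qed.

Lemma card_between1 R W : (R <= W)%VS ->
  #|between R W (\dim R).+1|%:R = (q ^+ (\dim W - \dim R) - 1) / (q - 1).
Proof.
have q1 := card_field_gt1; move=> /card_between_succ /(congr1 (fun i : nat => i%:R : rat)).
rewrite natrM !natrB ?expn_gt0 ?(ltnW (finNzRing_gt1 F)) // natrX => <-.
by rewrite mulfK // subr_eq0 gt_eqF.
Qed.

(** Double counting of the pairs [U' <= U] in the interval, with [U'] one dimension above [R] and
    [U] of dimension [\dim R + j.+1], reproduces the recursion of [gauss]. *)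
Lemma card_between R W j : (R <= W)%VS ->
  #|between R W (\dim R + j)%N|%:R = gauss q (\dim W - \dim R)%N j.
Proof.
have q1 := card_field_gt1.
have q_n0 i : q ^+ i.+1 - 1 != 0 by rewrite subr_eq0 gt_eqF ?exprn_egt1.
elim: j R => [|j IHj] R sRW /=.
  rewrite addn0 (_ : between _ _ _ = [set (R : [vsp vT])]) ?cards1 //.
  apply/setP => U; rewrite !inE; apply/and3P/eqP => [[sRU sUW /eqP dU]|->].
    by apply/esym/eq_subspace; rewrite ?dU.
  by rewrite subvv.
pose P (U U' : [vsp vT]) := (U' <= U)%VS.
have : \sum_(U in between R W (\dim R + j.+1)%N)
          \sum_(U' in between R W (\dim R).+1 | P U U') (1 : rat)
     = \sum_(U' in between R W (\dim R).+1)
          \sum_(U in between R W (\dim R + j.+1)%N | P U U') 1.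
  rewrite (exchange_big_dep (mem (between R W (\dim R).+1))) /= => [|U U' _ /andP[] //].
  by apply: eq_bigr => U' U'R; apply: eq_bigl => U; rewrite U'R.
under eq_bigr => U.
  rewrite inE => /and3P[sRU sUW /eqP dU].
  rewrite (eq_bigl (mem (between R U (\dim R).+1))) => [|U']; last first.
    rewrite !inE /P; case sUU: (U' <= U)%VS; rewrite ?andbF //=.
    by rewrite (subv_trans sUU sUW) andbT.
  rewrite sumr_const card_between1 // dU addKn; over.
under [X in _ = X]eq_bigr => U'.
  rewrite inE => /and3P[sRU sUW /eqP dU].
  rewrite (eq_bigl (mem (between U' W (\dim U' + j)%N))) => [|U]; last first.
    rewrite !inE /P dU addSnnS; case sUU: (U' <= U)%VS; rewrite ?andbF //=.
    by rewrite (subv_trans sRU sUU) andbT.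
  rewrite sumr_const IHj // dU subnS; over.
rewrite !sumr_const -[LHS]mulr_natr -[RHS]mulr_natr card_between1 // => e.
apply: (mulfI (q_n0 j)); rewrite mulrA mulrCA divff // mulr1.
apply: (mulIf (_ : (q - 1)^-1 != 0)); first by rewrite invr_eq0 subr_eq0 gt_eqF.
by rewrite mulrAC e mulrC -mulrAC.
Qed.

(** Take [D] inside [S + A], where it fits because [\dim (S :&: A) < t]. The space [U :&: (S + A)]
    contains [S + U :&: A], so it has codimension at most [k - t] in [S + A] and meets [D] in
    dimension greater than [\dim S]. The candidates for [R] depend on [A] but not on [U]; there are
    [theta] of them. *)
Lemma meet_extension S A k t : \dim A = k -> (t <= k)%N ->
  (\dim (S :&: A) < t)%N ->
  exists D, [/\ (S <= D)%VS, \dim D = (\dim S + (k - t).+1)%N &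
    forall U, (S <= U)%VS -> (t <= \dim (U :&: A))%N ->
      exists2 R : [vsp vT], R \in between S D (\dim S).+1 & (R <= U)%VS].
Proof.
move=> dA ltk lti; have dSA := dimv_sum_cap S A.
have [|D [sSD sDA dD]] := @subspace_extend _ _ _ _ (\dim S + (k - t).+1)%N (addvSl S A).
  by apply/andP; split; lia.
exists D; split=> // U sSU tU.
have dSUA := dimv_sum_cap S (U :&: A); rewrite capvA (capv_idPl sSU) in dSUA.
have sUA : (S + U :&: A <= U :&: (S + A))%VS.
  by rewrite subv_add !subv_cap sSU addvSl capvSl (subv_trans (capvSr _ _)) ?addvSr.
have /dimvS lUA := sUA.
have dUD := dimv_sum_cap (U :&: (S + A)) D.
have lDA : (\dim (U :&: (S + A) + D) <= \dim (S + A))%N.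
  by apply: dimvS; rewrite subv_add capvSr.
have [||R [sSR sRD dR]] :=
  @subspace_extend _ _ S (U :&: (S + A) :&: D) (\dim S).+1 _ _.
- by rewrite !subv_cap sSU addvSl.
- by apply/andP; split; lia.
exists R; last by rewrite (subv_trans sRD) // -capvA capvSl.
by rewrite inE sSR dR eqxx (subv_trans sRD) // capvSr.
Qed.

End Counting.

(** Union bound in which [B] collects the at most one exceptional member, the source of every [+ 1]
    in the recursion. *)
Lemma card_cover_le (R : realFieldType) (I T : finType) (A B : {set T}) (J : {set I})
    (G : I -> {set T}) (x : R) :
  (forall a, a \in A -> a \notin B -> exists2 i, i \in J & a \in G i) ->
  (#|B| <= 1)%N -> (forall i, i \in J -> #|G i|%:R <= x) ->
  #|A|%:R <= #|J|%:R * x + 1.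
Proof.
move=> cov B1 Gx; have sA : A \subset B :|: \bigcup_(i in J) G i.
  apply/subsetP => a aA; rewrite inE; case: (boolP (a \in B)) => //= aB.
  by have [i iJ aG] := cov _ aA aB; apply/bigcupP; exists i.
have sum_le : (#|\bigcup_(i in J) G i| <= \sum_(i in J) #|G i|)%N.
  elim/big_rec2: _ => [|i c D _ IH]; first by rewrite cards0.
  by apply: leq_trans (leq_card_setU _ _).1 _; rewrite leq_add2l.
have /(leq_trans (subset_leq_card sA)) : (#|B :|: \bigcup_(i in J) G i| <=
    \sum_(i in J) #|G i| + 1)%N.
  by apply: leq_trans (leq_card_setU _ _).1 _; rewrite addnC leq_add.
rewrite -(ler_nat R) natrD natr_sum => /le_trans; apply; rewrite lerD2r.
by apply: le_trans (ler_sum _ Gx) _; rewrite sumr_const mulr_natl.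
Qed.

(** * Bounds for an almost t-intersecting family *)

Section Family.

Variables (F : finFieldType) (vT : vectType F) (k t : nat) (Fam : {set [vsp vT]}).
Hypotheses (Fam_dim : Fam \subset kspaces vT k) (Fam_int : almost_t_intersecting t Fam).
Let q : rat := #|F|%:R.
Let n := \dim {:vT}.
Let theta := (q ^+ (k - t).+1 - 1) / (q - 1).

Definition containing (S : {vspace vT}) : {set [vsp vT]} :=
  [set X in Fam | (S <= X)%VS].

(** When [T] is itself a member, this is the set that [almost_t_intersecting] limits to one
    element. *)
Definition missing (T : {vspace vT}) : {set [vsp vT]} :=
  [set X in Fam | \dim (T :&: X) < t]%N.

Lemma card_containing_le S : (\dim S <= k)%N ->
  #|containing S|%:R <= gauss q (n - \dim S) (k - \dim S).
Proof.
move=> lSk; rewrite -card_between ?subvf // subnKC // ler_nat.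
apply/subset_leq_card/subsetP => X; rewrite !inE => /andP[XF ->]; rewrite subvf /=.
by have := subsetP Fam_dim _ XF; rewrite inE.
Qed.

Lemma card_containing_step S A (x : rat) : A \in missing S -> (t <= k)%N ->
  (forall R, (S <= R)%VS -> \dim R = (\dim S).+1 -> #|containing R|%:R <= x) ->
  #|containing S|%:R <= theta * x + 1.
Proof.
rewrite inE => /andP[AF mSA] ltk Rx.
have dA : \dim A = k by have := subsetP Fam_dim _ AF; rewrite inE => /eqP.
have [D [sSD dD ext]] := meet_extension dA ltk mSA.
have <- : #|between S D (\dim S).+1|%:R = theta.
  by rewrite card_between1 // dD addKn.
apply: (@card_cover_le _ _ _ _ [set B in Fam | \dim (A :&: B) < t]%N _
  (fun R : [vsp vT] => containing R)).
- move=> U; rewrite !inE => /andP[UF sSU]; rewrite UF -leqNgt capvC => tU.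
  have [R Rb sRU] := ext _ sSU tU; exists R => //.
  by rewrite inE UF.
- exact: Fam_int.
- by move=> R; rewrite inE => /and3P[sSR _ /eqP dR]; apply: Rx.
Qed.

Lemma card_family_le T (x : rat) : (t <= \dim T)%N -> (#|missing T| <= 1)%N ->
  (forall S, (S <= T)%VS -> \dim S = t -> #|containing S|%:R <= x) ->
  #|Fam|%:R <= gauss q (\dim T) t * x + 1.
Proof.
move=> ltT mT Sx; have := card_between t (sub0v T).
rewrite dimv0 add0n subn0 => <-.
apply: (card_cover_le (G := fun S : [vsp vT] => containing S)) _ mT _ => [U UF|S].
  rewrite inE UF -leqNgt => tU.
  (* A member outside [missing T] contains some t-subspace of [T], because its intersection with [T]
     is large enough. *)
  have [|S [_ sSTU dS]] := @subspace_extend _ _ _ _ t (sub0v (T :&: U)).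
    by rewrite dimv0.
  exists S; last by rewrite inE UF (subv_trans sSTU) ?capvSr.
  by rewrite inE sub0v dS eqxx (subv_trans sSTU) ?capvSl.
by rewrite inE => /and3P[_ sST /eqP dS]; apply: Sx.
Qed.

Lemma card_containing_iter m j S : (t <= k)%N -> (m <= k)%N ->
  (forall T, (t <= \dim T < m)%N -> missing T != set0) ->
  (t <= \dim S)%N -> (\dim S + j)%N = m ->
  #|containing S|%:R <= iter j (fun y => theta * y + 1) (gauss q (n - m) (k - m)).
Proof.
move=> ltk lmk missP; elim: j S => [|j IHj] S ltS dS.
  by rewrite -dS addn0; apply: card_containing_le; lia.
have /set0Pn[A AS] : missing S != set0 by apply: missP; lia.
by apply: (card_containing_step AS) => // R sSR dR; apply: IHj; lia.
Qed.

End Family.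

(* The families of maximum size *)
Local Close Scope ring_scope.

Theorem theorem1p1 (F : finFieldType) (vT : vectType F) (n k t : nat)
  (hn : 0 < n) (hk : 0 < k) (ht : 0 < t)
  (hkt : t + 1 <= k)
  (hdimV : \dim (fullv : {vspace vT}) = n)
  (hnk : 2 * k + 1 + (#|F| == 2) * (1 - (k == t + 1)) <= n)
  (Fam : {set [vsp vT]})
  (hsub : Fam \subset kspaces vT k)
  (hint : almost_t_intersecting t Fam)
  (hmax : forall G : {set [vsp vT]}, G \subset kspaces vT k ->
            almost_t_intersecting t G -> #|G| <= #|Fam|) :
  exists E : [vsp vT], \dim E = t /\
    Fam = [set X in kspaces vT k | (E <= X)%VS].
Proof.
pose q : rat := (#|F|%:R)%R; have q_ge2 : (2 <= q)%R by rewrite ler_nat finNzRing_gt1.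
have hkt1 : t < k by rewrite -addn1.
pose star (E : [vsp vT]) := [set X in kspaces vT k | (E <= X)%VS].
have card_star (E : [vsp vT]) : \dim E = t ->
    #|star E|%:R%R = gauss q (n - t)%N (k - t)%N.
  move=> dE; have := card_between (k - t) (subvf E).
  rewrite hdimV dE subnKC; last by lia.
  by move=> <-; congr _%:R%R; apply: eq_card => X; rewrite !inE subvf /= andbC.
have star_le (E : [vsp vT]) : \dim E = t -> #|star E| <= #|Fam|.
  move=> dE; apply: hmax; first by apply/subsetP => X; rewrite inE => /andP[].
  move=> X; rewrite inE => /andP[_ EX]; rewrite (_ : [set _ in _ | _] = set0) ?cards0 //.
  apply/setP => Y; rewrite !inE; apply/negbTE/negP => /andP[/andP[_ EY]].
  by rewrite ltnNge -dE dimvS // subv_cap EX EY.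
have [E0 [_ _ dE0]] : exists E : {vspace vT},
    [/\ (0 <= E)%VS, (E <= fullv)%VS & \dim E = t].
  by apply: subspace_extend; rewrite ?sub0v // dimv0 hdimV; lia.
have FamN : (gauss q (n - t)%N (k - t)%N <= #|Fam|%:R)%R.
  by rewrite -(card_star _ dE0) ler_nat star_le.
have /set0Pn[A0 A0F] : Fam != set0.
  apply: contraTneq FamN => ->; rewrite cards0 -ltNge.
  by apply: lt_le_trans ltr01 _; apply: gauss_ge1 => //; lia.
have dimFam A : A \in Fam -> \dim A = k.
  by move=> /(subsetP hsub); rewrite inE => /eqP.
pose P m := (t <= m) && [exists T : [vsp vT], (\dim T == m) && (#|missing t Fam T| <= 1)].
have exP : exists m, P m.
  exists k; apply/andP; split; first by lia.
  by apply/existsP; exists A0; rewrite dimFam // eqxx; apply: hint.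
have lmk : ex_minn exP <= k.
  case: ex_minnP => m _; apply; apply/andP; split; first by lia.
  by apply/existsP; exists A0; rewrite dimFam // eqxx; apply: hint.
move: lmk; case: ex_minnP => m /andP[ltm /existsP[T /andP[/eqP dT mT]]] minm lmk.
have bound := @bound_lt rat _ _ _ _ (finNzRing_gt1 F) ht hkt hnk.
have missP (T' : {vspace vT}) : t <= \dim T' < m -> missing t Fam T' != set0.
  move=> /andP[lt' ltm']; apply: contraTneq ltm' => m0; rewrite -leqNgt minm // /P lt' /=.
  by apply/existsP; exists T'; rewrite eqxx m0 cards0.
(* If [m > t], the family would be smaller than a star, against maximality. *)
move: ltm; rewrite leq_eqVlt => /predU1P[etm|ltm]; last first.
  suff : (#|Fam|%:R < gauss q (n - t)%N (k - t)%N)%R by rewrite ltNge FamN.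
  apply: le_lt_trans (bound m _); last by rewrite ltm.
  rewrite -hdimV -{1}dT. apply: card_family_le => //; first by lia.
  move=> S _ dS; apply: (card_containing_iter hsub hint) => //; lia.
(* Here [\dim T = t], so a member not missing [T] contains it; if none is missing, the family lies
   in the star of [T], and [star_le] forces equality. *)
have [miss0|/set0Pn[A AT]] := eqVneq (missing t Fam T) set0.
  exists T; split; first by rewrite dT.
  apply/eqP; rewrite eqEcard star_le ?dT // andbT; apply/subsetP => X XF.
  rewrite inE (subsetP hsub) //=.
  have /negbT : X \in missing t Fam T = false by rewrite miss0 inE.
  rewrite inE XF -leqNgt => tTX.
  by rewrite -(eq_subspace (capvSl T X)) ?capvSr // dT -etm.
suff : (#|Fam|%:R < gauss q (n - t)%N (k - t)%N)%R by rewrite ltNge FamN.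
(* Since [T] is its own only t-subspace, one extension step through the missing member [A] gives at
   most [theta * a + 2] members, which is at most [bound t.+1 + 1] because [gauss q t.+1 t >= 1]. *)
have := bound t.+1; rewrite ltnSn hkt1 subSnn => /(_ isT); apply: le_lt_trans.
set a := gauss q (n - t.+1) _; have theta0 : (0 <= (q ^+ (k - t).+1 - 1) / (q - 1))%R.
  by rewrite divr_ge0 ?subr_ge0 ?exprn_ege1 //; lra.
have a0 : (0 <= a)%R by apply: le_trans ler01 (gauss_ge1 q_ge2 _); lia.
apply: (@le_trans _ _ (gauss q (\dim T) t * ((q ^+ (k - t).+1 - 1) / (q - 1) * a + 1) + 1)%R).
  apply: card_family_le => //; first by rewrite dT etm.
  move=> S sST dS; have -> : S = T by apply: eq_subspace; rewrite ?dS ?dT ?etm.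
  apply: (card_containing_step hsub hint AT); first by lia.
  move=> R _; rewrite dT -etm => dR; rewrite /a -hdimV -dR.
  by apply: card_containing_le; rewrite // dR; lia.
rewrite dT -etm gauss_nn // mul1r lerD2r ler_peMl ?gauss_ge1 //.
by rewrite addr_ge0 ?(mulr_ge0 theta0 a0).
Qed.
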